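(* For every $\alpha\ge1$ and $\varepsilon\in(0,1/2)$ there is a polynomial-time $(3+\varepsilon,3)$-bicriteria approximation algorithm for $\alpha$-fair $k$-center.
   Context: Input: a finite set $P$ of $n$ points in a metric space $(X,d)$ and an integer $1\le k<n$. The $k$-center cost of $C$ is $\max_{v\in P}d(v,C)$. $B(v,\rho)=\{u\in P:d(v,u)\le\rho\}$; the fair radius $r(v)$ is the minimum $\rho\ge0$ with $|B(v,\rho)|\ge n/k$. $C\subseteq P$, $|C|\le k$, is $\alpha$-fair if $d(x,C)\le\alpha r(x)$ for all $x\in P$. A $(\beta',\gamma)$-bicriteria approximation outputs $S\subseteq P$, $|S|\le k$, that is $(\gamma\alpha)$-fair with $k$-center cost at most $\beta'$ times the minimum $k$-center cost over $\alpha$-fair sets. (The paper uses the known 3-approximation of Jones et al. for $k$-center under partition matroid constraint.) *)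

(* Defs.v *)
From HB Require Import structures.
From mathcomp Require Import all_boot all_order all_algebra.
From mathcomp Require Import classical_sets reals.
Set Implicit Arguments. Unset Strict Implicit. Unset Printing Implicit Defensive.
Import Order.TTheory GRing.Theory Num.Theory.
Local Open Scope ring_scope.

Section FairKCenter.
Variable R : realType.
Variable n : nat.
Variable d : 'I_n -> 'I_n -> R.

Definition is_metric : Prop :=
  [/\ forall x, d x x = 0,
      forall x y, x != y -> 0 < d x y,
      forall x y, d x y = d y x &
      forall x y z, d x z <= d x y + d y z].

Definition ball (v : 'I_n) (rho : R) : {set 'I_n} := [set u | d v u <= rho].

(* fair radius r(v) = min { rho >= 0 : |B(v,rho)| >= n/k } (taken as the inf,
   which is attained, hence is this minimum) *)
Definition fair_radius (k : nat) (v : 'I_n) : R :=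
  @inf R [set rho : R | 0 <= rho /\ (n%:R / k%:R : R) <= (#|ball v rho|)%:R].

Definition dist_le (x : 'I_n) (C : {set 'I_n}) (rho : R) : Prop :=
  exists2 c, c \in C & d x c <= rho.

Definition cost_le (C : {set 'I_n}) (rho : R) : Prop :=
  forall v, dist_le v C rho.

Definition alpha_fair (k : nat) (alpha : R) (C : {set 'I_n}) : Prop :=
  (#|C| <= k)%N /\ forall x, dist_le x C (alpha * fair_radius k x).

(* S is a valid output of a (beta', gamma)-bicriteria approximation:
   |S| <= k, S is (gamma*alpha)-fair, and cost(S) <= beta' * cost(C)
   for every alpha-fair C (i.e. <= beta' * the minimum over alpha-fair sets). *)
Definition bicriteria_output (k : nat) (alpha beta' gamma : R)
    (S : {set 'I_n}) : Prop :=
  [/\ (#|S| <= k)%N,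
      alpha_fair k (gamma * alpha) S &
      forall C, alpha_fair k alpha C ->
        forall rho, cost_le C rho -> cost_le S (beta' * rho)].
End FairKCenter.

(* Part 2: a real-RAM machine model (unit cost), to express polynomial time. *)
Inductive instr (R : Type) : Type :=
| RConst of nat & R
| RAdd of nat & nat & nat
| RSub of nat & nat & nat
| RMul of nat & nat & nat
| RDiv of nat & nat & nat
| RLoad of nat & nat
| RStore of nat & nat
| NConst of nat & nat
| NAdd of nat & nat & nat
| NSub of nat & nat & nat
| NLoad of nat & nat
| NStore of nat & nat
| RJle of nat & nat & nat
| NJle of nat & nat & nat
| Jmp of nat.

Record config (R : Type) := Config {
  pc : nat; rmem : nat -> R; nmem : nat -> nat }.

Section Machine.
Variable R : realType.

Definition upd {T : Type} (f : nat -> T) (i : nat) (v : T) : nat -> T :=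
  fun j => if j == i then v else f j.

Definition exec (ins : instr R) (s : config R) : config R :=
  let M := rmem s in let N := nmem s in let nx := (pc s).+1 in
  match ins with
  | RConst i c => Config nx (upd M i c) N
  | RAdd i j l => Config nx (upd M i (M j + M l)) N
  | RSub i j l => Config nx (upd M i (M j - M l)) N
  | RMul i j l => Config nx (upd M i (M j * M l)) N
  | RDiv i j l => Config nx (upd M i (M j / M l)) N
  | RLoad i a => Config nx (upd M i (M (N a))) N
  | RStore a i => Config nx (upd M (N a) (M i)) N
  | NConst i m => Config nx M (upd N i m)
  | NAdd i j l => Config nx M (upd N i (N j + N l)%N)
  | NSub i j l => Config nx M (upd N i (N j - N l)%N)
  | NLoad i a => Config nx M (upd N i (N (N a)))
  | NStore a i => Config nx M (upd N (N a) (N i))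
  | RJle j l p => Config (if M j <= M l then p else nx) M N
  | NJle j l p => Config (if (N j <= N l)%N then p else nx) M N
  | Jmp p => Config p M N
  end.

Definition step (p : seq (instr R)) (s : config R) : config R :=
  match drop (pc s) p with
  | [::] => s
  | ins :: _ => exec ins s
  end.

Definition run (p : seq (instr R)) (t : nat) (s : config R) : config R :=
  iter t (step p) s.

Definition halted (p : seq (instr R)) (s : config R) : bool :=
  (size p <= pc s)%N.

(* Input encoding: N 0 = n, N 1 = k, M (i*n + j) = d i j, everything else 0. *)
Definition init_config (n k : nat) (d : 'I_n -> 'I_n -> R) : config R :=
  Config 0
    (fun a => if (a < n * n)%N then
                match insub (a %/ n)%N, insub (a %% n)%N with
                | Some i, Some j => d i j
                | _, _ => 0
                end
              else 0)
    (fun a => if a == 0%N then n else if a == 1%N then k else 0%N).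

Definition output_set (n : nat) (s : config R) : {set 'I_n} :=
  [set i : 'I_n | nmem s (2 + i)%N != 0%N].

Definition poly_time_bicriteria_alg (alpha beta' gamma : R)
    (p : seq (instr R)) : Prop :=
  exists c : nat,
    forall (n k : nat) (d : 'I_n -> 'I_n -> R),
      (1 <= k < n)%N -> is_metric d ->
      exists t : nat,
        [/\ (t <= c * n.+1 ^ c)%N,
            halted p (run p t (init_config k d)) &
            bicriteria_output d k alpha beta' gamma
              (output_set n (run p t (init_config k d)))].
End Machine.

(* Main.v *)
(* Write r(x) for the fair radius, W x = 2 alpha r(x), and let S be the set of
   centers chosen so far.  Repeat k times: if some point x is uncovered, i.e.
   d(x,S) > W x, add an uncovered point with W minimal; otherwise add a point
   farthest from S.

   Points added while uncovered are pairwise at distance more than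
   alpha r(x) + alpha r(y), so their fair balls are disjoint.  Each fair ball has
   at least n/k points, so k + 1 of them cannot exist: after k rounds everything
   is covered and S is 2 alpha-fair.  If C is alpha-fair of cost rho and some
   point is at distance more than 2 rho from S, then this point together with S
   gives k + 1 points whose balls of radius min(alpha r, rho) are disjoint, and
   each of these balls meets C, contradicting |C| <= k.  Hence no guess of the
   optimal cost is needed and the cost is at most 2 rho. *)

Require Import Defs.
From HB Require Import structures.
From mathcomp Require Import all_boot all_order all_algebra.
From mathcomp Require Import classical_sets reals.
From mathcomp Require Import fintype finset zify lra.
Set Implicit Arguments. Unset Strict Implicit. Unset Printing Implicit Defensive.
Import Order.TTheory GRing.Theory Num.Theory.
Local Open Scope ring_scope.

(** * The greedy rule *)

Section Metric.
Variables (R : realType) (n : nat) (d : 'I_n -> 'I_n -> R).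
Hypothesis d_metric : is_metric d.

Lemma dist_ge0 x y : 0 <= d x y.
Proof.
case: d_metric => d0 dpos _ _.
by case: (eqVneq x y) => [->|/dpos/ltW //]; rewrite d0.
Qed.

Lemma dist_eq0 x y : (d x y <= 0) = (x == y).
Proof.
case: d_metric => d0 dpos _ _.
by case: (eqVneq x y) => [->|/dpos]; rewrite ?d0 ?lexx // leNgt => ->.
Qed.

(** * The fair radius as a maximum of distances *)

Section FairRadius.
Variable k : nat.
Hypothesis k_bounds : (1 <= k < n)%N.

(* Fewer than [n / k] points are strictly closer to [v] than [u]: the fair
   radius is the largest distance from [v] to such a point. *)
Definition early (v u : 'I_n) : bool := (#|[set w | (d v w < d v u)%R]| * k < n)%N.

Lemma early_self v : early v v.
Proof.
rewrite /early [X in #|pred_of_set X|](_ : _ = set0).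
  by rewrite cards0; case/andP: k_bounds; lia.
apply/setP => w; rewrite !inE; case: d_metric => -> _ _ _.
by apply/negbTE; rewrite -leNgt dist_ge0.
Qed.

(** If the ball of radius [rho] were too small, a nearest point outside it would be [early], since
    all points closer than it lie in the ball; this contradicts the upper bound. Conversely, a
    radius below [d v u] for an early [u] gives a ball of fewer than n/k points. Hence the radius
    can be found by counting alone. *)
Lemma fair_radius_max v (rho : R) :
  (forall u, early v u -> d v u <= rho) ->
  (exists2 u, early v u & rho = d v u) ->
  fair_radius d k v = rho /\ (n <= #|ball d v rho| * k)%N.
Proof.
rewrite /early => ub att.
have rho0 : 0 <= rho by case: att => u _ ->; apply: dist_ge0.
have /andP[k0 kn] := k_bounds.
have kR : 0 < (k%:R : R) by rewrite ltr0n.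
have big : (n <= #|ball d v rho| * k)%N.
  rewrite leqNgt; apply/negP => small.
  have [u0 u0N] : exists u, u \notin ball d v rho.
    apply/existsP; rewrite -negb_forall; apply/negP => /forallP all_in.
    have: #|ball d v rho| = n.
      rewrite -[RHS]card_ord -cardsT; congr #|pred_of_set _|.
      by apply/setP => u; rewrite (all_in u) inE.
    by move: small => /[swap] ->; nia.
  have [u uN umin] := @arg_minP _ _ _ u0 (fun u => u \notin ball d v rho) (d v) u0N.
  move: (uN); rewrite inE => /negP; apply; apply: ub.
  apply: leq_ltn_trans small; rewrite leq_mul2r; apply/orP; right.
  apply/subset_leq_card/subsetP => w; rewrite inE => w_lt.
  apply/negPn/negP => /umin; lra.
split=> //; apply/eqP; rewrite eq_le; apply/andP; split.
  apply: ge_inf; last first.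
    by split=> //; rewrite ler_pdivrMr // -natrM ler_nat.
  by exists 0 => x [].
apply: lb_le_inf.
  by exists rho; split=> //; rewrite ler_pdivrMr // -natrM ler_nat.
move=> s [s0]; rewrite ler_pdivrMr // -natrM ler_nat => s_big.
case: att => u u_small ->.
rewrite leNgt; apply/negP => s_lt.
move: u_small; rewrite ltnNge => /negP; apply; apply: leq_trans s_big _.
rewrite leq_mul2r; apply/orP; right.
by apply/subset_leq_card/subsetP => w; rewrite !inE => /le_lt_trans; apply.
Qed.

Lemma fair_radius_ball v : (n <= #|ball d v (fair_radius d k v)| * k)%N.
Proof.
have [u eu umax] := @arg_maxP _ _ _ v (early v) (d v) (early_self v).
by have [-> //] := @fair_radius_max v (d v u) umax (ex_intro2 _ _ u eu erefl).
Qed.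

(** As k < n, the fair ball has more than one point, and a second point is at positive distance. *)
Lemma fair_radius_gt0 v : 0 < fair_radius d k v.
Proof.
have /andP[k0 kn] := k_bounds; have big := fair_radius_ball v.
have : (1 < #|ball d v (fair_radius d k v)|)%N by nia.
move=> /card_gt1P[x [y [xb yb xy]]].
have [z] : exists2 z, z != v & z \in ball d v (fair_radius d k v).
  case: (eqVneq x v) xy => [->|xv _]; last by exists x.
  by rewrite eq_sym => yv; exists y.
case: d_metric => _ dpos _ _.
by rewrite inE eq_sym => /dpos; exact: lt_le_trans.
Qed.

End FairRadius.

(** * Packing disjoint balls around separated points *)

Definition separated (rho : 'I_n -> R) : seq 'I_n -> bool :=
  pairwise (fun x y => rho x + rho y < d x y).

Lemma separated_sub (rho rho' : 'I_n -> R) s :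
  (forall x, rho x <= rho' x) -> separated rho' s -> separated rho s.
Proof.
move=> le_rho; apply: sub_pairwise => x y.
by apply: le_lt_trans; apply: lerD.
Qed.

(** By the triangle inequality the balls are disjoint, so removing the first ball from [A] leaves
    the traces of the others intact; induct on the rest. *)
Lemma separated_cards (rho : 'I_n -> R) (A : {set 'I_n}) s :
  separated rho s ->
  (\sum_(x <- s) #|ball d x (rho x) :&: A| <= #|A|)%N.
Proof.
case: d_metric => _ _ dC dT.
rewrite /separated; elim: s A => [|x s IH] A /=; first by rewrite big_nil.
move=> /andP[xs /IH {}IH].
rewrite big_cons -(cardsID (ball d x (rho x)) A) (setIC A) leq_add2l.
apply: leq_trans (IH _).
rewrite big_seq [leqRHS]big_seq; apply: leq_sum => y ys.
apply/subset_leq_card/subsetP => u; rewrite !inE => /andP[yu ->].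
rewrite yu andbT /= -ltNge; move/allP: xs => /(_ y ys).
have := dT x u y; rewrite (dC u y); lra.
Qed.

(** The hypothesis is a lower bound m/j on each trace, without division. It serves with m/j = n/k on
    the whole space and with m/j = 1 on a fair set. *)
Lemma separated_size (rho : 'I_n -> R) (A : {set 'I_n}) m j s :
  separated rho s ->
  (forall x, x \in s -> (m <= #|ball d x (rho x) :&: A| * j)%N) ->
  (size s * m <= #|A| * j)%N.
Proof.
move=> /(separated_cards A) sepA mA.
apply: leq_trans (_ : (_ <= (\sum_(x <- s) #|ball d x (rho x) :&: A|) * j)%N) _.
  rewrite big_distrl /= -sum1_size big_distrl /= big_seq [leqRHS]big_seq.
  by apply: leq_sum => x /mA; rewrite mul1n.
by rewrite leq_mul2r sepA orbT.
Qed.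

(** * The greedy sequence and its separation properties *)

Section Greedy.
Variable W : 'I_n -> R.
Hypothesis W_gt0 : forall x, 0 < W x.

(* The cap [W x + 1] plays the role of the distance to the empty set: it
   exceeds [W x], so it leaves [x] uncovered. *)
Definition near (cs : seq 'I_n) (x : 'I_n) : R :=
  foldr (fun c m => Num.min m (d c x)) (W x + 1) cs.

(* Uncovered points have positive priority, decreasing in [W]; covered ones
   have negative priority, increasing in their distance to the centers. *)
Definition priority (w m : R) : R := if m <= w then -1 / (1 + m) else 1 / w.

(** The latest center comes first, so the tail is the state in which the head was chosen. *)
Fixpoint greedy (cs : seq 'I_n) : Prop :=
  if cs is c :: cs' then
    greedy cs' /\ forall x, priority (W x) (near cs' x) <= priority (W c) (near cs' c)
  else True.

Lemma near_le cs x c : c \in cs -> near cs x <= d c x.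
Proof.
elim: cs => //= b cs IH; rewrite inE => /orP[/eqP->|/IH h];
  by rewrite ge_min ?lexx ?h ?orbT.
Qed.

Lemma near_ge0 cs x : 0 <= near cs x.
Proof.
elim: cs => [|c cs IH] /=; first by rewrite addr_ge0 // ltW.
by rewrite le_min IH dist_ge0.
Qed.

Lemma near_attained cs x : near cs x <= W x -> exists2 c, c \in cs & d c x = near cs x.
Proof.
elim: cs => [|c cs IH] /=; first lra.
rewrite /Num.min; case: ifP => _ h; last by exists c; rewrite ?mem_head.
by have [b bcs bx] := IH h; exists b => //; rewrite inE bcs orbT.
Qed.

Lemma near_le0 cs x : (near cs x <= 0) = (x \in cs).
Proof.
case: d_metric => d0 _ _ _.
apply/idP/idP => [h|/(near_le x)]; last by rewrite d0.
have [c ccs cx] : exists2 c, c \in cs & d c x = near cs x.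
  by apply: near_attained; apply: le_trans h (ltW _).
by move: h; rewrite -cx dist_eq0 => /eqP <-.
Qed.

(** Every priority thus exceeds the start value -2 of the search in [select]. *)
Lemma priority_geN1 w m : 0 < w -> 0 <= m -> -1 <= priority w m.
Proof.
move=> w0 m0; rewrite /priority; case: ifP => _.
  by rewrite mulN1r lerN2 invf_le1; lra.
by rewrite (le_trans _ (_ : 0 <= _)) ?divr_ge0 //; lra.
Qed.

Lemma priority_uncovered w m w' m' : 0 < w -> 0 < w' -> 0 <= m -> 0 <= m' ->
  w < m -> priority w m <= priority w' m' -> w' < m' /\ w' <= w.
Proof.
move=> w0 w0' m0 m0' wm; rewrite /priority [m <= w]leNgt wm /=.
have iw : 0 < 1 / w by rewrite divr_gt0.
case: (leP m' w') => [_|wm'] h; last first.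
  by split=> //; move: h; rewrite !mul1r lef_pV2.
have : 0 < (1 + m')^-1 by rewrite invr_gt0; lra.
by move: h; rewrite mulN1r; lra.
Qed.

Lemma priority_covered w m w' m' : 0 < w -> 0 < w' -> 0 <= m -> 0 <= m' ->
  m' <= w' -> priority w m <= priority w' m' -> m <= m'.
Proof.
move=> w0 w0' m0 m0' wm; rewrite /priority wm.
have i' : 0 < (1 + m')^-1 by rewrite invr_gt0; lra.
have iw : 0 < 1 / w by rewrite divr_gt0.
case: (leP m w) => _; last by rewrite mulN1r; lra.
by rewrite !mulN1r lerN2 lef_pV2 ?posrE; lra.
Qed.

(** If [x] is uncovered after [c] was added, it was so before; hence [c] was uncovered too and
    [W c <= W x]. Induction separates both [x] and [c] from the earlier centers, and [d c x > W x]
    is at least the mean of [W x] and [W c]. *)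
Lemma greedy_uncovered cs x : greedy cs -> W x < near cs x ->
  separated (fun y => W y / 2) (x :: cs) /\ forall c, c \in cs -> W c <= W x.
Proof.
case: d_metric => _ _ dC _.
elim: cs x => [|c cs IH] x; first by [].
case=> gcs cmax; rewrite [near _ _]/= lt_min => /andP[xcs xc].
have [ccs Wc] := priority_uncovered (W_gt0 x) (W_gt0 c) (near_ge0 cs x)
  (near_ge0 cs c) xcs (cmax x).
have [sx Wx] := IH x gcs xcs.
have [sc _] := IH c gcs ccs.
split; last by move=> b; rewrite inE => /orP[/eqP->|/Wx].
move: sx sc; rewrite /separated /= => /andP[-> _] ->.
by rewrite !andbT dC; lra.
Qed.

(** If the last center [c] was covered when chosen, it was at least as far from the earlier centers
    as [x], so induction applies to [c]; otherwise [greedy_uncovered] does. The pair [x], [c] is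
    separated because its distance exceeds [2 * rho]. *)
Lemma greedy_far (rho : R) (rad : 'I_n -> R) cs x :
  (forall y, rad y <= W y / 2) -> (forall y, rad y <= rho) ->
  greedy cs -> 2 * rho < near cs x -> separated rad (x :: cs).
Proof.
move=> radW radr; case: d_metric => _ _ dC _.
elim: cs x => [|c cs IH] x; first by [].
case=> gcs cmax; rewrite [near _ _]/= lt_min => /andP[xcs xc].
have sx := IH x gcs xcs.
have sc : separated rad (c :: cs).
  have [cov|unc] := leP (near cs c) (W c).
    apply: IH => //; apply: lt_le_trans xcs _.
    exact: priority_covered (W_gt0 x) (W_gt0 c) (near_ge0 cs x)
      (near_ge0 cs c) cov (cmax x).
  by apply: separated_sub radW _; case: (greedy_uncovered gcs unc).
move: sx sc; rewrite /separated /= => /andP[-> _] ->.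
rewrite !andbT dC; have := radr x; have := radr c; lra.
Qed.

End Greedy.

Lemma greedy_bicriteria (k : nat) (alpha beta : R) (W : 'I_n -> R)
    cs (S : {set 'I_n}) :
  (1 <= k < n)%N -> 1 <= alpha -> 2 <= beta ->
  (forall x, W x = 2 * alpha * fair_radius d k x) ->
  greedy W cs -> size cs = k -> (forall x, (x \in S) = (x \in cs)) ->
  bicriteria_output d k alpha beta 3 S.
Proof.
move=> kb a1 b2 WE gcs szc SE.
have /andP[k0 kn] := kb.
have big := fair_radius_ball kb; have r0 := fair_radius_gt0 kb.
have ar0 x : fair_radius d k x <= alpha * fair_radius d k x.
  by rewrite ler_peMl // ltW.
have W0 x : 0 < W x by rewrite WE mulr_gt0 //; lra.
case: (d_metric) => _ _ dC _.
have cov x : near W cs x <= W x.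
  rewrite leNgt; apply/negP => unc.
  have [sep _] := greedy_uncovered W0 gcs unc.
  have /separated_size : separated (fair_radius d k) (x :: cs).
    by apply: separated_sub sep => y; rewrite WE; have := ar0 y; lra.
  move=> /(_ [set: 'I_n] n k) /=; rewrite szc cardsT card_ord => bnd.
  have : (k.+1 * n <= n * k)%N by apply: bnd => y _; rewrite setIT.
  by nia.
have att x : exists2 c, c \in S & d x c = near W cs x.
  have [c ccs cx] := near_attained (cov x).
  by exists c; rewrite ?SE // dC.
have Sk : (#|S| <= k)%N.
  by rewrite -szc (eq_card SE) card_size.
split=> //.
  split=> // x; have [c cS cx] := att x; exists c => //.
  by rewrite cx; apply: le_trans (cov x) _; rewrite WE; have := ar0 x; have := r0 x; nra.
move=> C [Ck Cfair] rho Crho x.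
have rho0 : 0 <= rho by have [c _] := Crho x; apply: le_trans (dist_ge0 _ _).
have [c cS cx] := att x; exists c => //.
suff : near W cs x <= 2 * rho by rewrite cx => /le_trans; apply; rewrite ler_wpM2r.
rewrite leNgt; apply/negP => far.
(* Fairness of [C] makes the ball of the first radius meet [C], the cost bound that of the second;
   so the smaller one always meets [C]. *)
pose rad y := Num.min (alpha * fair_radius d k y) rho.
have sep : separated rad (x :: cs).
  apply: (greedy_far W0 (rho := rho)) gcs far => y; rewrite /rad.
    by rewrite ge_min WE; apply/orP; left; lra.
  by rewrite ge_min lexx orbT.
have /= := separated_size (A := C) (m := 1) (j := 1) sep.
rewrite szc !muln1 => bnd; suff: (k.+1 <= #|C|)%N by rewrite ltnNge Ck.
apply: bnd => y _; rewrite muln1 card_gt0; apply/set0Pn.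
have [c1 c1C c1y] := Cfair y; have [c2 c2C c2y] := Crho y.
have [le|le] := leP (alpha * fair_radius d k y) rho.
  by exists c1; rewrite !inE c1C /rad min_l ?c1y.
by exists c2; rewrite !inE c2C /rad min_r ?c2y // ltW.
Qed.

End Metric.

(** * Structured programs on the real RAM *)

Section Structured.
Variable R : realType.

Lemma upd_same T (f : nat -> T) i v : upd f i v i = v.
Proof. by rewrite /upd eqxx. Qed.

Lemma upd_other T (f : nat -> T) i v j : j != i -> upd f i v j = f j.
Proof. by rewrite /upd => /negPf ->. Qed.

Inductive test := TNle of nat & nat | TRle of nat & nat.

Inductive cmd :=
| Ins of instr R
| Seq of cmd & cmd
| Unless of test & cmd
| Until of test & cmd.

Definition jump_if (T : test) (q : nat) : instr R :=
  match T with TNle i j => NJle _ i j q | TRle i j => RJle _ i j q end.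

Definition holds (T : test) (M : nat -> R) (N : nat -> nat) : bool :=
  match T with TNle i j => (N i <= N j)%N | TRle i j => M i <= M j end.

Fixpoint csize (c : cmd) : nat :=
  match c with
  | Ins _ => 1
  | Seq c1 c2 => csize c1 + csize c2
  | Unless _ c => (csize c).+1
  | Until _ c => (csize c).+2
  end%N.

(** Jumps are absolute, so the start address [b] is a parameter; a test that holds jumps past the
    body. *)
Fixpoint compile (c : cmd) (b : nat) : seq (instr R) :=
  match c with
  | Ins i => [:: i]
  | Seq c1 c2 => compile c1 b ++ compile c2 (b + csize c1)
  | Unless T c => jump_if T (b + (csize c).+1) :: compile c b.+1
  | Until T c => jump_if T (b + (csize c).+2) :: compile c b.+1 ++ [:: Jmp _ b]
  end%N.

Lemma size_compile c b : size (compile c b) = csize c.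
Proof.
elim: c b => //= [c1 h1 c2 h2|_ c h|_ c h] b;
  by rewrite ?size_cat /= ?h1 ?h2 ?h ?addn1.
Qed.

Definition is_jump (i : instr R) : bool :=
  match i with RJle _ _ _ | NJle _ _ _ | Jmp _ => true | _ => false end.

(* [L] bounds the number of iterations of every loop. *)
Fixpoint time (L : nat) (c : cmd) : nat :=
  match c with
  | Ins _ => 1
  | Seq c1 c2 => time L c1 + time L c2
  | Unless _ c => (time L c).+1
  | Until _ c => (L * (time L c).+2).+1
  end%N.

(** Each enclosing loop costs one more factor [L.+1]. One [K] serves as coefficient and exponent, so
    both grow together, with slack. *)
Lemma time_poly c : exists K, forall L, (time L c <= K * L.+1 ^ K)%N.
Proof.
elim: c => [i|c1 [K1 h1] c2 [K2 h2]|T c [K h]|T c [K h]] /=.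
- by exists 1%N => L; rewrite expn1 mul1n.
- exists (K1 + K2)%N => L; apply: leq_trans (leq_add (h1 L) (h2 L)) _.
  rewrite mulnDl leq_add // leq_mul2l leq_pexp2l ?orbT //.
    exact: leq_addr.
  exact: leq_addl.
- exists K.+1 => L; have := h L; rewrite expnS.
  have : (0 < L.+1 ^ K)%N by rewrite expn_gt0.
  move: (time L c) (L.+1 ^ K)%N => a X; nia.
- exists K.+3 => L; have := h L; rewrite !expnS.
  have : (0 < L.+1 ^ K)%N by rewrite expn_gt0.
  move: (time L c) (L.+1 ^ K)%N => a X X0 aX.
  apply: (@leq_trans (K.+3 * (L.+1 * X))%N); first by nia.
  rewrite leq_mul2l /=; nia.
Qed.

(* An indirect store counts as writing every register. *)
Definition nwrites (c : cmd) (r : nat) : bool :=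
  (fix go c := match c with
  | Ins (NConst i _) | Ins (NAdd i _ _) | Ins (NSub i _ _) | Ins (NLoad i _) => r == i
  | Ins (NStore _ _) => true
  | Ins _ => false
  | Seq c1 c2 => go c1 || go c2
  | Unless _ c | Until _ c => go c
  end) c.

Definition rwrites (c : cmd) (r : nat) : bool :=
  (fix go c := match c with
  | Ins (RConst i _) | Ins (RAdd i _ _) | Ins (RSub i _ _) | Ins (RMul i _ _)
  | Ins (RDiv i _ _) | Ins (RLoad i _) => r == i
  | Ins (RStore _ _) => true
  | Ins _ => false
  | Seq c1 c2 => go c1 || go c2
  | Unless _ c | Until _ c => go c
  end) c.

Definition frame (c : cmd) (M M' : nat -> R) (N N' : nat -> nat) : Prop :=
  (forall r, ~~ nwrites c r -> N' r = N r) /\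
  (forall r, ~~ rwrites c r -> M' r = M r).

Lemma frame_trans c M1 M2 M3 N1 N2 N3 :
  frame c M1 M2 N1 N2 -> frame c M2 M3 N2 N3 -> frame c M1 M3 N1 N3.
Proof.
by case=> n12 r12 [n23 r23]; split=> r h; rewrite ?n23 ?r23 ?n12 ?r12.
Qed.

(** * Timed weakest preconditions for compiled code *)

Definition code_at (p : seq (instr R)) (b : nat) (s : seq (instr R)) : Prop :=
  exists p1 p2, p = p1 ++ s ++ p2 /\ size p1 = b.

Lemma code_at_cat p b s1 s2 : code_at p b (s1 ++ s2) ->
  code_at p b s1 /\ code_at p (b + size s1) s2.
Proof.
case=> p1 [p2 [-> <-]]; split.
  by exists p1, (s2 ++ p2); rewrite !catA.
by exists (p1 ++ s1), p2; rewrite size_cat !catA.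
Qed.

Lemma code_at_cons p b i s : code_at p b (i :: s) ->
  (forall M N, step p (Config b M N) = exec i (Config b M N)) /\ code_at p b.+1 s.
Proof.
rewrite -cat1s => /code_at_cat[[p1 [p2 [-> <-]]]]; rewrite addn1; split=> //.
by move=> M N; rewrite /step /= drop_size_cat.
Qed.

Lemma run_add (p : seq (instr R)) t1 t2 s : run p (t1 + t2) s = run p t2 (run p t1 s).
Proof. by rewrite /run addnC iterD. Qed.

(** Total correctness within the time bound, wherever the code is placed. The frame is built in so
    that invariants mention only cells that change. *)
Definition wp (L : nat) (c : cmd) (Q : (nat -> R) -> (nat -> nat) -> Prop)
    (M : nat -> R) (N : nat -> nat) : Prop :=
  forall p b, code_at p b (compile c b) -> exists t M' N',
    [/\ (t <= time L c)%N,
        run p t (Config b M N) = Config (b + csize c) M' N',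
        frame c M M' N N' & Q M' N'].

Lemma wp_mono L c (Q Q' : (nat -> R) -> (nat -> nat) -> Prop) M N :
  wp L c Q M N -> (forall M' N', frame c M M' N N' -> Q M' N' -> Q' M' N') ->
  wp L c Q' M N.
Proof.
move=> h QQ p b /h[t [M' [N' [tL rn fr q]]]].
by exists t, M', N'; split=> //; apply: QQ.
Qed.

Lemma wp_ins L i (Q : (nat -> R) -> (nat -> nat) -> Prop) M N : ~~ is_jump i ->
  (let s := exec i (Config 0 M N) in Q (rmem s) (nmem s)) -> wp L (Ins i) Q M N.
Proof.
move=> nj q p b /code_at_cons[st _].
exists 1%N; rewrite /run /= st.
case: i nj q {st} => //= *; do 2 eexists; split; rewrite ?addn1 //; split=> //= r h;
  by rewrite upd_other.
Qed.

Lemma wp_seq L c1 c2 (Q : (nat -> R) -> (nat -> nat) -> Prop) M N :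
  wp L c1 (fun M' N' => wp L c2 Q M' N') M N -> wp L (Seq c1 c2) Q M N.
Proof.
move=> h p b /= /code_at_cat[/h[t1 [M1 [N1 [t1L rn1 fr1 w2]]]]].
rewrite size_compile => /w2[t2 [M2 [N2 [t2L rn2 fr2 q]]]].
exists (t1 + t2)%N, M2, N2; split=> //; first by rewrite leq_add.
  by rewrite run_add rn1 rn2 addnA.
case: fr1 fr2 => n1 r1 [n2 r2].
by split=> r /= /norP[a1 a2]; rewrite ?n2 ?n1 ?r2 ?r1.
Qed.

Lemma step_jump_if p b T q : (forall M N, step p (Config b M N) =
    exec (jump_if T q) (Config b M N)) ->
  forall M N, run p 1 (Config b M N) = Config (if holds T M N then q else b.+1) M N.
Proof. by rewrite /run /= => st M N; rewrite st; case: T {st}. Qed.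

Lemma wp_unless L T c (Q : (nat -> R) -> (nat -> nat) -> Prop) M N :
  (holds T M N -> Q M N) -> (~~ holds T M N -> wp L c Q M N) ->
  wp L (Unless T c) Q M N.
Proof.
move=> q w p b /= /code_at_cons[/step_jump_if st cd].
case: (boolP (holds T M N)) => hT.
  by exists 1%N, M, N; split; rewrite ?st ?hT //; apply: q.
have [t [M' [N' [tL rn fr q']]]] := w hT _ _ cd.
exists t.+1, M', N'; split=> //.
by rewrite -add1n run_add st (negPf hT) rn addSnnS.
Qed.

(** The invariant is indexed by the number of completed iterations, which is exactly [m] at exit;
    each iteration may use the frame accumulated since entry. *)
Lemma wp_until L T c (I : nat -> (nat -> R) -> (nat -> nat) -> Prop) m
    (Q : (nat -> R) -> (nat -> nat) -> Prop) M N :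
  (m <= L)%N -> I 0%N M N ->
  (forall i M' N', (i < m)%N -> frame c M M' N N' -> I i M' N' ->
     ~~ holds T M' N' /\ wp L c (I i.+1) M' N') ->
  (forall M' N', frame c M M' N N' -> I m M' N' -> holds T M' N' /\ Q M' N') ->
  wp L (Until T c) Q M N.
Proof.
move=> mL I0 body fin p b /= /code_at_cons[/step_jump_if st /code_at_cat[cd]].
rewrite size_compile => /code_at_cons[back _].
have iters i : (i <= m)%N -> exists t M' N',
    [/\ (t <= i * (time L c).+2)%N, run p t (Config b M N) = Config b M' N',
        frame c M M' N N' & I i M' N'].
  elim: i => [_|i IH im]; first by exists 0%N, M, N; split.
  have [t [M1 [N1 [tL rn fr Ii]]]] := IH (ltnW im).
  have [hT w] := body _ _ _ im fr Ii.
  have [t' [M2 [N2 [tL' rn' fr' Ii']]]] := w _ _ cd.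
  (* One step for the test and one for the jump back, whence the [.+2] in [time]. *)
  exists (t + (1 + (t' + 1)))%N, M2, N2; split=> //.
  - by rewrite mulSn; lia.
  - rewrite !run_add rn st (negPf hT) rn'.
    by rewrite /run /= back.
  - exact: frame_trans fr fr'.
have [t [M1 [N1 [tL rn fr Im]]]] := iters m (leqnn m).
have [hT q] := fin _ _ fr Im.
exists (t + 1)%N, M1, N1; split=> //; last by rewrite run_add rn st hT.
by rewrite addn1 ltnS (leq_trans tL) // leq_mul2r mL orbT.
Qed.

(* Register 2 is a scratch register, clobbered by the increment. *)
Definition For (i j : nat) (c : cmd) : cmd :=
  Seq (Ins (NConst _ i 0)) (Until (TNle j i)
    (Seq c (Seq (Ins (NConst _ 2 1)) (Ins (NAdd _ i i 2))))).

(** The two [upd] after the body are the effect of the increment, so the invariant always refers to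
    the memory at the loop test. *)
Lemma wp_for L i j c (I : nat -> (nat -> R) -> (nat -> nat) -> Prop) m
    (Q : (nat -> R) -> (nat -> nat) -> Prop) M N :
  [&& i != j, i != 2%N, j != 2%N, ~~ nwrites c i & ~~ nwrites c j] ->
  (m <= L)%N -> N j = m ->
  I 0%N M (upd N i 0%N) ->
  (forall t M' N', (t < m)%N -> frame (For i j c) M M' N N' -> N' i = t ->
     I t M' N' -> wp L c (fun M'' N'' => I t.+1 M'' (upd (upd N'' 2 1%N) i t.+1)) M' N') ->
  (forall M' N', frame (For i j c) M M' N N' -> I m M' N' -> Q M' N') ->
  wp L (For i j c) Q M N.
Proof.
case/and5P => ij i2 j2 ci cj mL Nj I0 body fin.
have sub M' N' : frame (Seq c (Seq (Ins (NConst _ 2 1)) (Ins (NAdd _ i i 2))))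
    M M' (upd N i 0%N) N' -> frame (For i j c) M M' N N'.
  case=> hn hr; split=> r /=; last exact: hr.
  by case/norP => ri /hn ->; rewrite upd_other.
apply: wp_seq; apply: wp_ins => //=.
apply: (wp_until (I := fun t M' N' => N' i = t /\ I t M' N') mL).
- by rewrite upd_same.
- move=> t M' N' tm fr [N'i It]; split.
    have [hn _] := sub _ _ fr.
    rewrite /= N'i -ltnNge (_ : N' j = m) // -Nj; apply: hn => /=.
    by rewrite -!(eq_sym i) (negPf ij) (negPf cj) (negPf j2).
  apply: wp_seq; apply: wp_mono (body _ _ _ tm (sub _ _ fr) N'i It) _.
  move=> M2 N2 [hn _] q.
  apply: wp_seq; apply: wp_ins => //=; apply: wp_ins => //=.
  by rewrite !upd_same upd_other // hn // N'i addn1.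
- move=> M' N' fr [N'i Im]; split; last exact: fin (sub _ _ fr) Im.
  have [hn _] := sub _ _ fr.
  rewrite /= N'i (_ : N' j = m) // -Nj; apply: hn => /=.
  by rewrite -!(eq_sym i) (negPf ij) (negPf cj) (negPf j2).
Qed.

End Structured.

(** * The program *)

Lemma flat_lt n (x y : 'I_n) : (x * n + y < n * n)%N.
Proof. by have := ltn_ord x; have := ltn_ord y; nia. Qed.

Lemma card_prefix n (P : pred 'I_n) (t : 'I_n) :
  #|[set w : 'I_n | (w < t.+1)%N && P w]| = (P t + #|[set w : 'I_n | (w < t)%N && P w]|)%N.
Proof.
rewrite (cardsD1 t) inE ltnSn /=; congr (_ + #|pred_of_set _|)%N.
apply/setP => w; rewrite !inE -val_eqE /=; case: (P w); rewrite ?andbF ?andbT //.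
by lia.
Qed.

Lemma ord_ltS n t (tn : (t < n)%N) (P : 'I_n -> Prop) :
  (forall x : 'I_n, (x < t)%N -> P x) -> P (Ordinal tn) ->
  forall x : 'I_n, (x < t.+1)%N -> P x.
Proof.
move=> Plt Pt x; rewrite ltnS leq_eqVlt => /orP[/eqP e|]; last exact: Plt.
by rewrite (_ : x = Ordinal tn) //; apply: val_inj.
Qed.

Section Program.
Variables (R : realType) (alpha : R).

Local Notation "c1 ;; c2" := (Seq c1 c2) (at level 90, right associativity).
Local Coercion Ins : instr >-> cmd.

(* Instructions name registers by constant addresses, which collide with the
   input matrix (real cells [0 .. n^2-1]) and with the output (integer cells
   [2 .. n+1]).  So the matrix is first moved to [D0 = n^2 + n + 32], with real
   cell 0 as the only scratch cell, and the output is written last, using only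
   the integer registers 0 and 1.  In between, real cells below 32 are registers,
   cell [32 + x] holds the distance of [x] to the centers, cell [32 + n] a
   negative sentinel that stops the output loop, and [W0 + x] holds [W x], where
   [W0 = D0 + n^2].
   Integer registers: 3 = n^2, 4 = D0, 5 = W0, 6 = 32, 9 = address,
   12 = current row of the matrix, 14 = row of the selected center. *)
Definition copy_input : cmd R :=
  NConst _ 3 0;; For 8 0 (NAdd _ 3 3 0);;
  NConst _ 6 32;; NAdd _ 4 3 0;; NAdd _ 4 4 6;; NAdd _ 5 4 3;;
  For 8 3 (RLoad _ 0 8;; NAdd _ 9 4 8;; RStore _ 9 0).

(** Adding k rather than 1 per closer point yields directly the product that [early] compares with
    n. *)
Definition count_closer : cmd R :=
  For 11 0 (NAdd _ 9 12 11;; RLoad _ 2 9;; Unless (TRle 1 2) (NAdd _ 13 13 1)).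

(** A running maximum over the early points; adding the constant 0 copies a register. *)
Definition row_radius : cmd R :=
  For 10 0 (
    NAdd _ 9 12 10;; RLoad _ 1 9;; NConst _ 13 0;; count_closer;;
    Unless (TNle 0 13) (Unless (TRle 1 3) (RConst 4 0;; RAdd _ 3 1 4))).

Definition radii : cmd R :=
  NConst _ 12 0;; NAdd _ 12 12 4;;
  For 8 0 (
    RConst 3 0;; row_radius;;
    RConst 4 (2 * alpha);; RMul _ 3 4 3;; NAdd _ 9 5 8;; RStore _ 9 3;;
    RConst 4 1;; RAdd _ 3 3 4;; NAdd _ 9 6 8;; RStore _ 9 3;;
    NAdd _ 12 12 0);;
  RConst 4 (-1);; NAdd _ 9 6 0;; RStore _ 9 4.

Definition select : cmd R :=
  RConst 3 (-2);; NConst _ 12 0;; NAdd _ 12 12 4;;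
  For 8 0 (
    NAdd _ 9 6 8;; RLoad _ 1 9;; NAdd _ 9 5 8;; RLoad _ 2 9;;
    RConst 4 1;; RAdd _ 5 4 1;; RConst 6 (-1);; RDiv _ 5 6 5;;
    Unless (TRle 1 2) (RDiv _ 5 4 2);;
    Unless (TRle 5 3) (RConst 4 0;; RAdd _ 3 5 4;; NConst _ 14 0;; NAdd _ 14 14 12);;
    NAdd _ 12 12 0).

Definition update : cmd R :=
  For 8 0 (
    NAdd _ 9 14 8;; RLoad _ 1 9;; NAdd _ 9 6 8;; RLoad _ 2 9;;
    Unless (TRle 2 1) (RStore _ 9 1)).

Definition add_centers : cmd R := For 15 1 (select;; update).

(* Centers are recognised by their distance 0 to the set of centers. *)
Definition write_output : cmd R :=
  RConst 4 0;; RConst 6 (-1);; NConst _ 0 32;; RLoad _ 5 0;;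
  Until (TRle 5 6) (
    NConst _ 1 30;; NSub _ 0 0 1;; NConst _ 1 1;; Unless (TRle 5 4) (NConst _ 1 0);;
    NStore _ 0 1;; NConst _ 1 31;; NAdd _ 0 0 1;; RLoad _ 5 0).

Definition fair_center : cmd R := copy_input;; radii;; add_centers;; write_output.

(** * Correctness of each phase of the program *)

Section Correctness.
Variables (n k L : nat) (d : 'I_n -> 'I_n -> R).
Hypotheses (k_bounds : (1 <= k < n)%N) (d_metric : is_metric d) (nnL : (n * n <= L)%N).

Local Notation D0 := (n * n + n + 32)%N.
Local Notation W0 := (n * n + n + 32 + n * n)%N.
Local Notation W := (fun x => 2 * alpha * fair_radius d k x).

Definition layout (N : nat -> nat) : Prop :=
  [/\ N 0%N = n, N 1%N = k, N 4%N = D0, N 5%N = W0 & N 6%N = 32%N].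

Definition has_dist (M : nat -> R) : Prop :=
  forall x y : 'I_n, M (D0 + (x * n + y))%N = d x y.

Definition has_W (M : nat -> R) : Prop := forall x : 'I_n, M (W0 + x)%N = W x.

Let nL : (n <= L)%N. Proof. by apply: leq_trans nnL; nia. Qed.
Let nn_gt0 : (0 < n * n)%N. Proof. by case/andP: k_bounds; nia. Qed.
Let kL : (k <= L)%N. Proof. by apply: leq_trans nL; case/andP: k_bounds; lia. Qed.

Ltac rd := repeat match goal with |- context [upd ?f ?i ?v ?j] =>
  first [rewrite (upd_same f i v) | rewrite (@upd_other _ f i v j); [|first [by []|lia]]] end.
Ltac ins := apply: wp_ins => //=.
Ltac st := apply: wp_seq; ins.

Lemma wp_copy_input M N : N 0%N = n -> N 1%N = k ->
  (forall x y : 'I_n, M (x * n + y)%N = d x y) ->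
  wp L copy_input (fun M' N' => layout N' /\ has_dist M') M N.
Proof.
move=> N0 N1 Md; st; apply: wp_seq.
(* Integers can only be added, so n^2 is formed by n additions. *)
apply: (wp_for (I := fun t _ N' => N' 3%N = (t * n)%N) (m := n)) => //.
  move=> t M' N' tn [fn fm] N8 N3; ins; rd.
  by rewrite N3 (fn 0%N) // /upd /= N0 mulSn addnC.
move=> M1 N1' [fn fm] N3.
have N10 : N1' 0%N = n by rewrite fn.
have N11 : N1' 1%N = k by rewrite fn.
have M1E a : M1 a = M a by rewrite fm.
do 4 st; rd.
(* Scratch cell 0 overwrites only entry 0, which is read first, and the targets lie beyond the
   source; so unread entries survive. *)
apply: (wp_for (m := (n * n)%N) (I := fun t M' _ =>
  (forall a, (t <= a < n * n)%N -> M' a = M a) /\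
  (forall a, (a < t)%N -> M' (D0 + a)%N = M a))) => //.
  move=> t M' N' tn [fn' fm'] N8 [src dst].
  have N4 : N' 4%N = D0 by rewrite fn' //= /upd /= N3 N10.
  do 2 st; ins; rd; rewrite N4 N8; split=> a ha.
    by rd; apply: src; lia.
  have [->|at_] := eqVneq a t; first by rd; apply: src; lia.
  by rd; apply: dst; lia.
move=> M' N' [fn' fm'] [_ dst]; split.
  by split; rewrite fn' // /upd /= ?N3 ?N10 ?N11.
by move=> x y; rewrite dst ?flat_lt ?Md.
Qed.

Lemma wp_count_closer (v u : 'I_n) M N : N 0%N = n -> N 1%N = k -> N 12%N = (D0 + v * n)%N ->
  N 13%N = 0%N -> M 1%N = d v u -> has_dist M ->
  wp L count_closer
    (fun _ N' => N' 13%N = (#|[set w | (d v w < d v u)%R]| * k)%N) M N.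
Proof.
move=> N0 N1 N12 N13 M1 Md.
apply: (wp_for (m := n) (I := fun t _ N' =>
   N' 13%N = (#|[set w : 'I_n | (w < t)%N && (d v w < d v u)%R]| * k)%N)) => //.
- by rd; rewrite N13 [X in #|pred_of_set X|](_ : _ = set0) ?cards0 //;
    apply/setP => w; rewrite !inE.
- move=> t M' N' tn [fn fm] N11 IH; pose w := Ordinal tn.
  have M'1 : M' 1%N = d v u by rewrite fm.
  have M'w : M' (N' 12 + t)%N = d v w.
    rewrite fn //= N12 -addnA -[t]/(nat_of_ord w) -Md; apply: fm => /=; lia.
  do 2 st; apply: wp_unless => /=; rewrite /upd /= N11 M'1 M'w.
    by rewrite leNgt => /negPf c; rewrite (card_prefix _ w) c.
  by rewrite -ltNge => c; ins; rd; rewrite (card_prefix _ w) c IH (fn 1%N) // N1 add1n mulSn addnC.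
- move=> M' N' _ ->; congr (#|pred_of_set _| * _)%N.
  by apply/setP => w; rewrite !inE ltn_ord.
Qed.

Lemma wp_row_radius (v : 'I_n) M N : N 0%N = n -> N 1%N = k -> N 12%N = (D0 + v * n)%N ->
  M 3%N = 0 -> has_dist M ->
  wp L row_radius (fun M' _ => M' 3%N = fair_radius d k v) M N.
Proof.
move=> N0 N1 N12 M3 Md.
apply: (wp_for (m := n) (I := fun t M' _ =>
   (forall u : 'I_n, (u < t)%N -> early d k v u -> d v u <= M' 3%N) /\
   (exists2 u, early d k v u & M' 3%N = d v u))) => //.
(* The initial maximum 0 is the distance from [v] to itself, and [v] is early. *)
- split=> //; exists v; first exact: early_self.
  by case: d_metric => -> _ _ _.
- move=> t M' N' tn [fn fm] N10 [ub att]; pose u := Ordinal tn.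
  have M'd : has_dist M' by move=> x y; rewrite -Md; apply: fm => /=; lia.
  have M'u : M' (N' 12 + t)%N = d v u by rewrite fn //= N12 -addnA -[t]/(nat_of_ord u).
  do 3 st; rd; rewrite N10 M'u; apply: wp_seq.
  have w : wp L count_closer
      (fun _ N' => N' 13%N = (#|[set w | (d v w < d v u)%R]| * k)%N)
      (upd M' 1 (d v u)) (upd (upd N' 9 (N' 12 + t)) 13 0)%N.
    apply: wp_count_closer; rd; rewrite ?fn // => x y; rd; exact: M'd.
  apply: wp_mono w _ => M2 N2 [fn2 fm2] N13.
  have M21 : M2 1%N = d v u by rewrite fm2.
  have M23 : M2 3%N = M' 3%N by rewrite fm2.
  have eE : (N2 0 <= N2 13)%N = ~~ early d k v u.
    by rewrite N13 fn2 //= /upd /= fn // N0 -leqNgt.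
  apply: wp_unless => /=; rewrite eE => eu.
    split; last by case: att => u' e1 e2; exists u'; rewrite ?M23.
    by apply: (ord_ltS (tn := tn)) => [u' /ub|e]; rewrite ?M23 //; case/negP: eu.
  move/negPn: eu => eu.
  apply: wp_unless => /=; rewrite M21 M23 => le.
    split; last by case: att => u' e1 e2; exists u'; rewrite ?M23.
    by apply: (ord_ltS (tn := tn)) => [u' /ub|e]; rewrite ?M23.
  st; ins; rd; rewrite addr0 M21; split; last by exists u.
  apply: (ord_ltS (tn := tn)) => // u' /ub ub' /ub' /le_trans; apply.
  by move: le; rewrite -ltNge => /ltW.
- move=> M' N' _ [ub att].
  by have [-> //] := fair_radius_max d_metric k_bounds (fun u => ub u (ltn_ord u)) att.
Qed.

Lemma wp_radii M N : layout N -> has_dist M ->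
  wp L radii (fun M' N' => [/\ layout N', has_dist M', has_W M',
    forall x : 'I_n, M' (32 + x)%N = W x + 1 & M' (32 + n)%N = -1]) M N.
Proof.
move=> [N0 N1 N4 N5 N6] Md; do 2 st; apply: wp_seq.
apply: (wp_for (m := n) (I := fun t M' N' => [/\ N' 12%N = (D0 + t * n)%N, has_dist M',
   forall x : 'I_n, (x < t)%N -> M' (W0 + x)%N = W x &
   forall x : 'I_n, (x < t)%N -> M' (32 + x)%N = W x + 1])) => //.
- by split=> //; rd; rewrite N4; lia.
- move=> t M' N' tn [fn _] N8 [N12 Md' MW Mm]; pose v := Ordinal tn.
  have [N'0 N'1 N'5 N'6] : [/\ N' 0%N = n, N' 1%N = k, N' 5%N = W0 & N' 6%N = 32%N].
    by split; rewrite fn.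
  st; apply: wp_seq.
  have w : wp L row_radius (fun M' _ => M' 3%N = fair_radius d k v) (upd M' 3 0) N'.
    by apply: wp_row_radius; rd => // x y; rd; exact: Md'.
  apply: wp_mono w _ => M2 N2 [fn2 fm2] M23.
  have {}fm2 a : (32 <= a)%N -> M2 a = M' a.
    by move=> h; rewrite fm2 /=; rd => //; lia.
  do 8 st; ins; rd; rewrite !fn2 // N'0 N'5 N'6 N8 N12 M23.
  split; first by rewrite mulSn; lia.
  + by move=> x y; have := flat_lt x y => h; rd; rewrite fm2 ?Md' //; lia.
  + apply: (ord_ltS (tn := tn)) => [x xt|/=]; rd => //.
    by rewrite fm2 ?MW //; lia.
  + apply: (ord_ltS (tn := tn)) => [x xt|/=]; rd => //.
    by rewrite fm2 ?Mm //; lia.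
- move=> M' N' [fn _] [_ Md' MW Mm].
  have [N'0 N'1 N'4 N'5 N'6] : layout N' by split; rewrite fn.
  do 2 st; ins; rd; rewrite N'0 N'6; split.
  + by split; rd.
  + by move=> x y; rd; exact: Md'.
  + by move=> x; rd; exact: MW.
  + by move=> x; have := ltn_ord x => h; rd; exact: Mm.
  + by rd.
Qed.

Hypothesis alpha_ge1 : 1 <= alpha.

Let W_gt0 x : 0 < W x.
Proof. by rewrite mulr_gt0 ?fair_radius_gt0 //; have := alpha_ge1; lra. Qed.

Definition has_near (cs : seq 'I_n) (M : nat -> R) : Prop :=
  (forall x : 'I_n, M (32 + x)%N = near d W cs x) /\ M (32 + n)%N = -1.

Lemma wp_select cs M N : layout N -> has_dist M -> has_W M -> has_near cs M ->
  wp L select (fun M' N' => exists2 c : 'I_n, N' 14%N = (D0 + c * n)%N &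
    forall x, priority (W x) (near d W cs x) <= priority (W c) (near d W cs c)) M N.
Proof.
move=> [N0 N1 N4 N5 N6] Md MW [Mm _]; do 3 st.
pose key x := priority (W x) (near d W cs x).
(* The value -2 means that no point has been taken yet; at the end it is excluded by
   [priority_geN1]. *)
apply: (wp_for (m := n) (I := fun t M' N' => [/\ N' 12%N = (D0 + t * n)%N,
   forall x : 'I_n, (x < t)%N -> key x <= M' 3%N &
   M' 3%N = -2 \/ exists2 c : 'I_n, N' 14%N = (D0 + c * n)%N & M' 3%N = key c])) => //.
- by split=> //; rd; [rewrite N4; lia|left].
- move=> t M' N' tn [fn fm] N8 [N12 ub att]; pose v := Ordinal tn.
  have [N'0 N'1 N'5 N'6] : [/\ N' 0%N = n, N' 1%N = k, N' 5%N = W0 & N' 6%N = 32%N].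
    by split; rewrite fn.
  have {}fm a : (32 <= a)%N -> M' a = M a.
    by move=> h; rewrite fm /=; rd => //; lia.
  have M'W : M' (W0 + t)%N = W v by rewrite fm ?(MW v) //; lia.
  have M'm : M' (32 + t)%N = near d W cs v by rewrite fm ?(Mm v) //; lia.
  do 8 st; rd; rewrite N'5 N'6 N8; rd; rewrite M'W M'm.
  set M2 := upd _ 5 _; set N2 := upd _ 9 _.
  apply: wp_seq; apply: (wp_mono (Q := fun M3 N3 => [/\ M3 5%N = key v,
    M3 3%N = M' 3%N, N3 0%N = n, N3 12%N = (D0 + t * n)%N & N3 14%N = N' 14%N])).
    apply: wp_unless => /= [le|nle].
      by split; rewrite /M2 /N2; rd => //; rewrite /key /priority ifT //;
        move: le; rewrite /M2; rd.
    by ins; split; rewrite /M2 /N2; rd => //; rewrite /key /priority ifN //;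
        move: nle; rewrite /M2; rd.
  move=> M3 N3 _ [M35 M33 N30 N312 N314].
  apply: wp_seq; apply: wp_unless => /= le; last (do 3 st; ins);
    ins; rd; rewrite ?N30 ?N312.
    split; rd; first by rewrite mulSn; lia.
      apply: (ord_ltS (tn := tn)) => [x xt|/=]; last by rewrite -M35.
      by rewrite M33 ub.
    by rewrite M33 N314.
  split; rd; first by rewrite mulSn; lia.
    rewrite addr0 M35; apply: (ord_ltS (tn := tn)) => // x xt.
    by move: le; rewrite -ltNge M35 M33 => /ltW; apply: le_trans; exact: ub.
  by right; exists v; rewrite ?addr0.
- move=> M' N' _ [_ ub att].
  have n0 : (0 < n)%N by case/andP: k_bounds; lia.
  case: att => [M3|[c N14 M3]]; last by exists c => // x; rewrite -/(key x) -/(key c) -M3 ub.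
  have := ub (Ordinal n0) n0; rewrite M3.
  have : -1 <= key (Ordinal n0) by apply: priority_geN1 => //; apply: near_ge0.
  lra.
Qed.

Lemma wp_update cs (c : 'I_n) M N : layout N -> N 14%N = (D0 + c * n)%N ->
  has_dist M -> has_W M -> has_near cs M ->
  wp L update (fun M' _ => [/\ has_dist M', has_W M' & has_near (c :: cs) M']) M N.
Proof.
move=> [N0 N1 N4 N5 N6] N14 Md MW [Mm Mend].
apply: (wp_for (m := n) (I := fun t M' _ => [/\ has_dist M', has_W M',
   forall x : 'I_n, (x < t)%N -> M' (32 + x)%N = near d W (c :: cs) x,
   forall x : 'I_n, (t <= x)%N -> M' (32 + x)%N = near d W cs x &
   M' (32 + n)%N = -1])) => //.
- move=> t M' N' tn [fn _] N8 [Md' MW' done_ todo end_]; pose v := Ordinal tn.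
  have [N'6 N'14] : N' 6%N = 32%N /\ N' 14%N = (D0 + c * n)%N by split; rewrite fn.
  have M'd : M' (D0 + c * n + t)%N = d c v by rewrite -addnA -[t]/(nat_of_ord v).
  have M'm : M' (32 + t)%N = near d W cs v by rewrite -[t]/(nat_of_ord v) todo.
  do 4 st; rd; rewrite N'6 N'14 N8; rd; rewrite M'd M'm.
  apply: wp_unless => /=; rd => le; last (ins; rd).
    split; rd => //.
    + by move=> x y; rd; exact: Md'.
    + by move=> x; rd; exact: MW'.
    + by apply: (ord_ltS (tn := tn)) => [x xt|/=]; rd; [exact: done_|rewrite M'm /= min_l].
    + by move=> x xt; rd; apply: todo; lia.
  split; rd => //.
  + by move=> x y; rd; exact: Md'.
  + by move=> x; rd; exact: MW'.
  + apply: (ord_ltS (tn := tn)) => [x xt|/=]; rd; first exact: done_.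
    by rewrite /= min_r // ltW // ltNge.
  + by move=> x xt; rd; apply: todo; lia.
- by move=> M' N' _ [Md' MW' done_ _ end_]; split=> //; split=> // x; apply: done_.
Qed.

Lemma wp_add_centers M N : layout N -> has_dist M -> has_W M ->
  (forall x : 'I_n, M (32 + x)%N = W x + 1) -> M (32 + n)%N = -1 ->
  wp L add_centers (fun M' _ => exists cs,
    [/\ size cs = k, greedy d W cs & has_near cs M']) M N.
Proof.
move=> [N0 N1 N4 N5 N6] Md MW Mm Mend.
apply: (wp_for (m := k) (I := fun t M' _ => [/\ has_dist M', has_W M' & exists cs,
    [/\ size cs = t, greedy d W cs & has_near cs M']])) => //.
- by split=> //; exists [::]; split.
- move=> t M' N' tk [fn _] N15 [Md' MW' [cs [szcs gcs nearcs]]].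
  have lN : layout N' by split; rewrite fn.
  apply: wp_seq; apply: wp_mono (wp_select lN Md' MW' nearcs) _.
  move=> M2 N2 [fn2 fm2] [c N14 cmax].
  have {}fm2 a : (32 <= a)%N -> M2 a = M' a.
    by move=> h; rewrite fm2 //=; lia.
  have lN2 : layout N2 by case: lN => *; split; rewrite fn2.
  have : wp L update (fun M' _ => [/\ has_dist M', has_W M' & has_near (c :: cs) M']) M2 N2.
    apply: wp_update => // [x y|x|]; first by rewrite fm2 ?Md' //; lia.
      by rewrite fm2 ?MW' //; lia.
    by case: nearcs => h1 h2; split=> [x|]; rewrite fm2 ?h1 ?h2 //; lia.
  move=> w; apply: wp_mono w _ => M3 N3 _ [Md3 MW3 near3]; split=> //.
  by exists (c :: cs); rewrite /= szcs.
- by move=> M' N' _ [].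
Qed.

(** The register holding n is reused here, so the sentinel ends the loop: genuine distances are
    nonnegative and only cell [32 + n] holds -1. *)
Lemma wp_write_output cs M N : has_near cs M ->
  wp L write_output (fun _ N' => forall x : 'I_n, (N' (2 + x)%N != 0%N) = (x \in cs)) M N.
Proof.
move=> [Mm Mend]; do 4 st; rd.
apply: (wp_until (m := n) (I := fun t M' N' => [/\ N' 0%N = (32 + t)%N,
   M' 5%N = M (32 + t)%N &
   forall x : 'I_n, (x < t)%N -> (N' (2 + x)%N != 0%N) = (x \in cs)])) => //.
- move=> t M' N' tn [_ fm] [N0 M5 out]; pose v := Ordinal tn.
  have M'4 : M' 4%N = 0 by rewrite fm.
  have M'6 : M' 6%N = -1 by rewrite fm.
  have {}fm a : (32 <= a)%N -> M' a = M a.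
    by move=> h; rewrite fm /=; rd => //; lia.
  have M5v : M' 5%N = near d W cs v by rewrite M5 (Mm v).
  have in_cs : (M' 5%N <= 0) = (v \in cs) by rewrite M5v near_le0.
  split=> /=.
    rewrite M'6 M5v -ltNge (lt_le_trans _ (near_ge0 _ _ _ _)) //; lra.
  (* Subtracting 30 turns the distance address into the output address; adding 31 afterwards moves
     to the next distance. *)
  do 3 st; rd; rewrite N0 (_ : 32 + t - 30 = 2 + t)%N; last by lia.
  apply: wp_seq; apply: (wp_mono (Q := fun M2 N2 => [/\ N2 0%N = (2 + t)%N,
     (N2 1%N != 0%N) = (v \in cs), forall a, (1 < a)%N -> N2 a = N' a &
     forall a, M2 a = M' a])).
    apply: wp_unless => /=; rewrite M'4 in_cs => hv; last ins.
      by split=> [||a a1|//]; rd; rewrite ?hv.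
    by split=> [||a a1|//]; rd; rewrite ?(negPf hv).
  move=> M2 N2 _ [N20 N21 N2a M2a].
  do 3 st; ins; rd; rewrite N20 M2a fm; last by lia.
  split; [by lia|by congr M; lia|].
  apply: (ord_ltS (tn := tn)) => [x xt|/=]; rd => //.
  by rewrite N2a ?out.
- move=> M' N' [_ fm] [N0 M5 out]; split; last by move=> x; apply: out.
  by rewrite /= M5 Mend fm.
Qed.

Lemma wp_fair_center M N : N 0%N = n -> N 1%N = k ->
  (forall x y : 'I_n, M (x * n + y)%N = d x y) ->
  wp L fair_center (fun _ N' => exists cs, [/\ size cs = k, greedy d W cs &
    forall x : 'I_n, (N' (2 + x)%N != 0%N) = (x \in cs)]) M N.
Proof.
move=> N0 N1 Md.
apply: wp_seq; apply: wp_mono (wp_copy_input N0 N1 Md) _ => M1 N1' _ [l1 d1].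
apply: wp_seq; apply: wp_mono (wp_radii l1 d1) _ => M2 N2 _ [l2 d2 W2 m2 end2].
apply: wp_seq; apply: wp_mono (wp_add_centers l2 d2 W2 m2 end2) _.
move=> M3 N3 _ [cs [szcs gcs ncs]].
apply: wp_mono (wp_write_output N3 ncs) _ => M4 N4 _ out.
by exists cs.
Qed.

End Correctness.
End Program.

(** * Input encoding and assembly of the algorithm *)

Lemma init_config_dist (R : realType) n k (d : 'I_n -> 'I_n -> R) (x y : 'I_n) :
  rmem (init_config k d) (x * n + y)%N = d x y.
Proof.
have n0 : (0 < n)%N by apply: leq_ltn_trans (ltn_ord x).
rewrite /= flat_lt divnMDl // modnMDl divn_small // addn0 modn_small //.
by rewrite !valK.
Qed.

Theorem mainTheorem7 (R : realType) (alpha eps : R) :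
  1 <= alpha -> 0 < eps -> eps < 1 / 2 ->
  exists p : seq (instr R),
    poly_time_bicriteria_alg alpha (3 + eps) 3 p.
Proof.
move=> alpha1 eps0 _.
exists (compile (fair_center alpha) 0).
have [K timeK] := time_poly (fair_center alpha).
(* With the loop bound L = n^2 + 2n one has L + 1 = (n+1)^2, so the degree K in L + 1 becomes 2K in
   n + 1. *)
exists (2 * K)%N => n k d kb dm.
have nnL : (n * n <= n * n + 2 * n)%N by lia.
have [|t [M' [N' [tL rn _ [cs [szcs gcs out]]]]]] :=
  wp_fair_center kb dm nnL alpha1 (N := nmem (init_config k d))
    erefl erefl (init_config_dist k d) (p := compile (fair_center alpha) 0) (b := 0).
  by exists [::], [::]; rewrite cats0.
rewrite -/(init_config k d) in rn.
exists t; rewrite rn; split.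
- apply: leq_trans tL (leq_trans (timeK _) _).
  have -> : (n * n + 2 * n).+1 = (n.+1 ^ 2)%N by rewrite -mulnn; lia.
  by rewrite -expnM leq_mul2r leq_pmull ?orbT.
- by rewrite /halted size_compile.
- apply: (greedy_bicriteria dm kb alpha1 _ (fun=> erefl) gcs szcs); first lra.
  by move=> x; rewrite inE out.
Qed.
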